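(* Assume $\lambda(x,x)=1$ for all $x\in\Gamma$, and let $\mathcal{A}$ be a $(\Gamma,\lambda)$-commutative algebra over $\mathbb{K}$. For all $\varsigma\in\mathfrak{S}(\lambda)$, there exists a finitely generated subgroup $\mathbb{U}\le\mathbb{K}^\times$ such that $$\Gamma\!\det{}_\varsigma:\ \mathsf{hGL}(\boldsymbol{\nu};\mathcal{A})\to\Big(\bigcup_{\gamma\in\Gamma}(\mathcal{A}^\times\cap\mathcal{A}^\gamma)\Big)\Big/\mathbb{U}$$ is a group morphism for all $\boldsymbol{\nu}\in\bigcup_{n\ge1}\Gamma^n$. Moreover, $\mathbb{U}$ can be chosen as the subgroup of $\mathbb{K}^\times$ generated by $\{\varsigma(x,y)^2:x,y\in\Gamma\}$.
   Context: $\mathbb{K}$ is a field of characteristic zero and $\Gamma$ is a finitely generated abelian group. $\lambda:\Gamma\times\Gamma\to\mathbb{K}^\times$ is a commutation factor: biadditive with $\lambda(x,y)\lambda(y,x)=1$. A $(\Gamma,\lambda)$-commutative algebra is an associative unital $\Gamma$-graded $\mathbb{K}$-algebra $\mathcal{A}=\bigoplus_\gamma\mathcal{A}^\gamma$ with $ab=\lambda(\tilde a,\tilde b)ba$ for homogeneous $a,b$ ($\tilde a$ is the degree). $\mathcal{A}^\times$ is the group of invertible elements; $\bigcup_\gamma(\mathcal{A}^\times\cap\mathcal{A}^\gamma)$ is the group of homogeneous invertible elements, and $\mathbb{K}^\times$ acts on it through multiples of the unit, the quotient by $\mathbb{U}$ being the quotient by the central subgroup $\mathbb{U}\cdot1_{\mathcal{A}}$.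 In the purely even case ($\lambda(x,x)=1$ for all $x$), $\mathfrak{S}(\lambda)$ is the set of biadditive maps $\varsigma:\Gamma\times\Gamma\to\mathbb{K}^\times$ with $\lambda(x,y)\varsigma(x,y)\varsigma(y,x)^{-1}=1$. For $\varsigma\in\mathfrak{S}(\lambda)$, $\underline{\mathcal{A}}$ is the vector space $\mathcal{A}$ with the commutative product $a\star b=\varsigma(\tilde a,\tilde b)ab$. For $\boldsymbol{\nu}\in\Gamma^n$, an $n\times n$ matrix $X$ over $\mathcal{A}$ is homogeneous of degree $x$ if $X^i_{\ j}\in\mathcal{A}^{x-\nu_i+\nu_j}$ for all $i,j$. $\mathsf{hGL}(\boldsymbol{\nu};\mathcal{A})$ is the group of invertible homogeneous matrices (of arbitrary degree). For $X$ homogeneous of degree $x$, $J_\varsigma(X)$ is the matrix over $\underline{\mathcal{A}}$ with entries $\varsigma(x,\nu_j)\varsigma(\nu_i,x-\nu_i+\nu_j)^{-1}X^i_{\ j}$, and $\Gamma\!\det_\varsigma(X)=\det_{\underline{\mathcal{A}}}(J_\varsigma(X))$, regarded as an element of $\mathcal{A}$ (and then of the quotient). *)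

(* Defs.v *)
From HB Require Import structures.
From mathcomp Require Import all_boot all_order all_algebra.
From mathcomp Require Import finmap generic_quotient.
From mathcomp Require Import ring.
From mathcomp Require Import boolp classical_sets.

Set Implicit Arguments.
Unset Strict Implicit.
Unset Printing Implicit Defensive.

Import GRing.Theory.
Local Open Scope ring_scope.
Local Open Scope quotient_scope.

Section Subgroup.
Variable G : groupType.

Definition generated (S : set G) : {pred G} :=
  [pred x | `[< forall H : groupClosed G, (forall y, S y -> y \in H) -> x \in H >]].

Fact generated_mulg_closed S : mulg_closed (generated S).
Proof.
move=> x y /asboolP Sx /asboolP Sy; apply/asboolP => H SH.
by apply: gpredM; [exact: Sx | exact: Sy].
Qed.

Fact generated1 S : 1%g \in generated S.
Proof. by apply/asboolP => H _; exact: gpred1. Qed.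

Fact generated_invg_closed S : invg_closed (generated S).
Proof. by move=> x /asboolP Sx; apply/asboolP => H SH; apply/gpredVr/Sx. Qed.

HB.instance Definition _ S :=
  isMulClosed.Build G (generated S) (@generated_mulg_closed S).
HB.instance Definition _ S := isMul1Closed.Build G (generated S) (generated1 S).
HB.instance Definition _ S :=
  isInvClosed.Build G (generated S) (@generated_invg_closed S).

Definition finitely_generated (H : groupClosed G) : Prop :=
  exists s : seq G, H =i generated (fun x => x \in s).

Definition group_of (H : groupClosed G) : Type := {x : G | x \in H}.

HB.instance Definition _ (H : groupClosed G) := SubChoice.on (group_of H).

Fact group_of_closed (H : groupClosed G) : group_closed [in H].
Proof. by split=> [|x y Hx Hy]; [exact: gpred1 | exact: gpredF]. Qed.

HB.instance Definition _ (H : groupClosed G) :=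
  SubChoice_isSubGroup.Build G [in H] (group_of H) (group_of_closed H).

End Subgroup.

Section QuotientGroup.
Variables (G : groupType) (N : groupClosed G).
Hypothesis normalN : forall x y : G, x \in N -> (x ^ y)%g \in N.

Definition coset_rel : rel G := fun x y => (x / y)%g \in N.

Fact coset_rel_refl : reflexive coset_rel.
Proof. by move=> x; rewrite /coset_rel mulgV gpred1. Qed.
Fact coset_rel_sym : symmetric coset_rel.
Proof. by move=> x y; rewrite /coset_rel -gpredV invgF. Qed.
Fact coset_rel_trans : transitive coset_rel.
Proof.
by move=> y x z Nxy Nyz; rewrite /coset_rel -[x](mulgVK y) -mulgA gpredM.
Qed.

Canonical coset_equiv :=
  EquivRel coset_rel coset_rel_refl coset_rel_sym coset_rel_trans.

(* The normality proof is a parameter of the type, since the group structure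
   depends on it. *)
Definition quotg of (forall x y : G, x \in N -> (x ^ y)%g \in N) : Type :=
  {eq_quot coset_rel}.
Local Notation Q := (quotg normalN).
HB.instance Definition _ := Choice.on Q.
HB.instance Definition _ := EqQuotient.on Q.

Definition quotg_one : Q := lift_cst Q 1%g.
Definition quotg_mul := lift_op2 Q (fun x y : G => x * y)%g.
Definition quotg_inv := lift_op1 Q (fun x : G => x^-1)%g.

Fact pi_quotg_mul : {morph \pi_Q : x y / (x * y)%g >-> quotg_mul x y}.
Proof.
move=> x y; unlock quotg_mul; apply/eqmodP; rewrite /= /coset_rel.
have /eqmodP := reprK (\pi_Q x : Q); rewrite /= => Nx.
have /eqmodP := reprK (\pi_Q y : Q); rewrite /= => Ny.
set x' := repr _ in Nx *; set y' := repr _ in Ny *.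
move: Nx Ny; rewrite coset_rel_sym [coset_rel y' y]coset_rel_sym /coset_rel => Nx Ny.
have -> : ((x * y) / (x' * y') = (x / x') * (y / y') ^ (x'^-1))%g.
  by rewrite /conjg invgK invgM !mulgA mulgVK.
by rewrite gpredM// normalN.
Qed.

Fact pi_quotg_inv : {morph \pi_Q : x / (x^-1)%g >-> quotg_inv x}.
Proof.
move=> x; unlock quotg_inv; apply/eqmodP; rewrite /= /coset_rel.
have /eqmodP := reprK (\pi_Q x : Q); rewrite /= /coset_rel.
set x' := repr _ => Nx; rewrite invgK.
have -> : (x^-1 * x' = (x' / x) ^ x)%g.
  by rewrite /conjg !mulgA mulgVK.
exact: normalN.
Qed.

Canonical pi_quotg_mul_morph := PiMorph2 pi_quotg_mul.
Canonical pi_quotg_inv_morph := PiMorph1 pi_quotg_inv.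
Canonical pi_quotg_one_morph := PiConst quotg_one.

Fact quotg_mulA : associative quotg_mul.
Proof. by elim/quotW => x; elim/quotW => y; elim/quotW => z; rewrite !piE mulgA. Qed.
Fact quotg_mul1g : left_id quotg_one quotg_mul.
Proof. by elim/quotW => x; rewrite !piE mul1g. Qed.
Fact quotg_mulg1 : right_id quotg_one quotg_mul.
Proof. by elim/quotW => x; rewrite !piE mulg1. Qed.
Fact quotg_mulVg : left_inverse quotg_one quotg_inv quotg_mul.
Proof. by elim/quotW => x; rewrite !piE mulVg. Qed.
Fact quotg_mulgV : right_inverse quotg_one quotg_inv quotg_mul.
Proof. by elim/quotW => x; rewrite !piE mulgV. Qed.

HB.instance Definition _ := isGroup.Build Q
  quotg_mulA quotg_mul1g quotg_mulg1 quotg_mulVg quotg_mulgV.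

End QuotientGroup.

Section Units.
Variable R : pzRingType.

(* Two-sided inverses, so that R need not be a unitRingType. *)
Definition invertible : {pred R} :=
  [pred a | `[< exists b : R, a * b = 1 /\ b * a = 1 >]].
Definition units : Type := {a : R | a \in invertible}.
HB.instance Definition _ := SubChoice.on units.

Fact units_one_subproof : 1 \in invertible.
Proof. by apply/asboolP; exists 1; rewrite mulr1. Qed.
Definition units_one : units := exist _ 1 units_one_subproof.

Fact units_mul_subproof (u v : units) : val u * val v \in invertible.
Proof.
have /asboolP [u' [uu' u'u]] := valP u; have /asboolP [v' [vv' v'v]] := valP v.
apply/asboolP; exists (v' * u'); split.
  by rewrite mulrA -[_ * _ * v']mulrA vv' mulr1.
by rewrite mulrA -[_ * _ * val u]mulrA u'u mulr1.
Qed.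
Definition units_mul (u v : units) : units :=
  exist _ (val u * val v) (units_mul_subproof u v).

Definition units_inv_val (u : units) : R := projT1 (cid (asboolW (valP u))).
Fact units_inv_valP (u : units) :
  val u * units_inv_val u = 1 /\ units_inv_val u * val u = 1.
Proof. exact: projT2 (cid (asboolW (valP u))). Qed.
Fact units_inv_subproof (u : units) : units_inv_val u \in invertible.
Proof.
by apply/asboolP; exists (val u); have [] := units_inv_valP u; split.
Qed.
Definition units_inv (u : units) : units :=
  exist _ (units_inv_val u) (units_inv_subproof u).

Fact units_mulA : associative units_mul.
Proof. by move=> u v w; apply: val_inj; rewrite /= mulrA. Qed.
Fact units_mul1 : left_id units_one units_mul.
Proof. by move=> u; apply: val_inj; rewrite /= mul1r. Qed.
Fact units_mulr1 : right_id units_one units_mul.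
Proof. by move=> u; apply: val_inj; rewrite /= mulr1. Qed.
Fact units_mulV : left_inverse units_one units_inv units_mul.
Proof. by move=> u; apply: val_inj; have [] := units_inv_valP u. Qed.
Fact units_mulrV : right_inverse units_one units_inv units_mul.
Proof. by move=> u; apply: val_inj; have [] := units_inv_valP u. Qed.
HB.instance Definition _ := isGroup.Build units
  units_mulA units_mul1 units_mulr1 units_mulV units_mulrV.

End Units.

Definition finitely_generated_zmod (Γ : zmodType) : Prop :=
  exists s : seq Γ, forall x, exists c : 'I_(size s) -> int,
    x = \sum_(i < size s) s`_i *~ c i.

Definition biadditive (Γ : zmodType) (G : groupType) (f : Γ -> Γ -> G) : Prop :=
  (forall x y z, f (x + y) z = f x z * f y z)%g /\
  (forall x y z, f x (y + z) = f x y * f x z)%g.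

Definition commutation_factor (Γ : zmodType) (K : fieldType)
    (lam : Γ -> Γ -> units K) : Prop :=
  biadditive lam /\ forall x y, (lam x y * lam y x = 1)%g.

(* The elements of the set written S(lambda) when lambda(x, x) = 1. *)
Record multiplier (Γ : zmodType) (K : fieldType) (lam : Γ -> Γ -> units K) :=
  Multiplier {
    mult_fun :> Γ -> Γ -> units K;
    mult_biadditive : biadditive mult_fun;
    mult_twist : forall x y, (lam x y * mult_fun x y * (mult_fun y x)^-1 = 1)%g
  }.

Record comm_grading (Γ : zmodType) (K : fieldType) (lam : Γ -> Γ -> units K)
    (A : algType K) := CommGrading {
  (* piece x a: the element a belongs to the component A^x. *)
  piece :> Γ -> A -> Prop;
  piece0 : forall x, piece x 0;
  pieceP : forall x (c : K) a b, piece x a -> piece x b -> piece x (c *: a + b);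
  piece1 : piece 0 1;
  pieceM : forall x y a b, piece x a -> piece y b -> piece (x + y) (a * b);
  (* A is the direct sum of the pieces: each a is a sum of homogeneous elements
     for exactly one finitely supported family. *)
  piece_sum : forall a, exists! f : {fsfun Γ -> A with 0},
    (forall x, piece x (f x)) /\ a = \sum_(x <- finsupp f) f x;
  piece_comm : forall x y a b, piece x a -> piece y b ->
    a * b = val (lam x y) *: (b * a)
}.

Section Grading.
Variables (Γ : zmodType) (K : fieldType) (lam : Γ -> Γ -> units K).
Variables (A : algType K) (gr : comm_grading lam A).

Definition component (a : A) : {fsfun Γ -> A with 0} := projT1 (cid (piece_sum gr a)).

Lemma component_piece a x : gr x (component a x).
Proof. by rewrite /component; case: cid => f /= [[]]. Qed.

Lemma sum_component a : \sum_(x <- finsupp (component a)) component a x = a.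
Proof. by rewrite /component; case: cid => f /= [[]]. Qed.

Lemma component_uniq a (S : {fset Γ}) (f : Γ -> A) :
  (forall x, gr x (f x)) -> a = \sum_(x <- S) f x ->
  forall x, component a x = if x \in S then f x else 0.
Proof.
move=> grf aE x; rewrite /component; case: cid => g /= [_ g_uniq].
rewrite (g_uniq [fsfun z in S => f z]) ?fsfun_fun //; split=> [y|].
  by rewrite fsfun_fun; case: ifP => // _; exact: piece0.
rewrite aE (big_fset_incl _ (finsupp_sub _ _ _)); last first.
  by move=> y _; rewrite memNfinsupp => /eqP.
by rewrite !big_seq; apply: eq_bigr => y yS; rewrite fsfun_fun yS.
Qed.

Lemma sum_component_sub (S : {fset Γ}) a :
  (finsupp (component a) `<=` S)%fset -> a = \sum_(x <- S) component a x.
Proof.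
move=> sub; rewrite -[LHS]sum_component; apply: big_fset_incl => // x _.
by rewrite memNfinsupp => /eqP.
Qed.

Lemma component_notin a x : x \notin finsupp (component a) -> component a x = 0.
Proof. by rewrite memNfinsupp => /eqP. Qed.

Lemma pieceD x a b : gr x a -> gr x b -> gr x (a + b).
Proof. by move=> ga gb; rewrite -[a]scale1r; apply: pieceP. Qed.

Lemma pieceZ x c a : gr x a -> gr x (c *: a).
Proof. by move=> ga; rewrite -[_ *: _]addr0; apply: pieceP => //; exact: piece0. Qed.

Lemma piece_bigsum x (I : Type) (r : seq I) (F : I -> A) :
  (forall i, gr x (F i)) -> gr x (\sum_(i <- r) F i).
Proof. by move=> grF; elim/big_ind: _ => // [|a b]; [exact: piece0 | exact: pieceD]. Qed.

Lemma component_lin c a b x :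
  component (c *: a + b) x = c *: component a x + component b x.
Proof.
set S := (finsupp (component a) `|` finsupp (component b))%fset.
have Ea := @sum_component_sub S a (fsubsetUl _ _).
have Eb := @sum_component_sub S b (fsubsetUr _ _).
rewrite (@component_uniq _ S (fun x => c *: component a x + component b x)).
- case: ifP => // /negbT; rewrite inE negb_or => /andP [xa xb].
  by rewrite !component_notin// scaler0 addr0.
- by move=> y; apply: pieceP; exact: component_piece.
by rewrite big_split /= -scaler_sumr -Ea -Eb.
Qed.

Fact component0 x : component 0 x = 0.
Proof.
by have := component_lin (-1) 0 0 x; rewrite scaler0 addr0 scaleN1r addNr.
Qed.

Fact componentD a b x : component (a + b) x = component a x + component b x.
Proof. by rewrite -[a in LHS]scale1r component_lin scale1r. Qed.

Lemma component_sum x (I : Type) (r : seq I) (F : I -> A) :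
  component (\sum_(i <- r) F i) x = \sum_(i <- r) component (F i) x.
Proof.
apply: (big_morph (fun a => component a x)); last exact: component0.
by move=> a b; exact: componentD.
Qed.

Lemma component_homog x a : gr x a ->
  forall y, component a y = if y == x then a else 0.
Proof.
move=> ga y.
rewrite (@component_uniq _ [fset x]%fset (fun z => if z == x then a else 0)).
- by rewrite inE; case: eqP.
- by move=> z; case: eqP => [->//|_]; exact: piece0.
by rewrite big_seq_fset1 eqxx.
Qed.

Lemma component_mull x y a b : gr x a ->
  component (a * b) (x + y) = a * component b y.
Proof.
move=> ga; rewrite -[b in LHS]sum_component mulr_sumr component_sum.
under eq_bigr => z _.
  rewrite (component_homog (pieceM ga (component_piece b z))).
  rewrite (inj_eq (addrI x)); over.
case: (boolP (y \in finsupp (component b))) => yb.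
  rewrite (big_fsetD1 y yb) /= eqxx big_seq big1 ?addr0 // => z.
  by rewrite !inE eq_sym => /andP [/negPf -> _].
rewrite (component_notin yb) mulr0 big_seq big1 // => z zb.
by case: eqP => // yz; rewrite yz zb in yb.
Qed.

Lemma piece_inv x a b : gr x a -> a * b = 1 -> b * a = 1 -> gr (- x) b.
Proof.
move=> ga ab ba; suff -> : b = component b (- x) by exact: component_piece.
have: a * component b (- x) = 1.
  by rewrite -(component_mull (- x) b ga) subrr ab (component_homog (piece1 gr)) eqxx.
by move=> /(congr1 (fun c => b * c)); rewrite mulrA ba mul1r mulr1.
Qed.

Definition homogeneous_units : {pred units A} :=
  [pred u | `[< exists x, gr x (val u) >]].

Fact homogeneous_units_mulg_closed : mulg_closed homogeneous_units.
Proof.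
move=> u v /asboolP [x ux] /asboolP [y vy]; apply/asboolP.
by exists (x + y); exact: pieceM.
Qed.
Fact homogeneous_units1 : 1%g \in homogeneous_units.
Proof. by apply/asboolP; exists 0; exact: piece1. Qed.
Fact homogeneous_units_invg_closed : invg_closed homogeneous_units.
Proof.
move=> u /asboolP [x ux]; apply/asboolP; exists (- x).
by have [] := units_inv_valP u; exact: piece_inv.
Qed.
HB.instance Definition _ :=
  isMulClosed.Build (units A) homogeneous_units homogeneous_units_mulg_closed.
HB.instance Definition _ :=
  isMul1Closed.Build (units A) homogeneous_units homogeneous_units1.
HB.instance Definition _ :=
  isInvClosed.Build (units A) homogeneous_units homogeneous_units_invg_closed.

Definition homogeneous_mx (n : nat) (ν : 'I_n -> Γ) (x : Γ) (X : 'M[A]_n) : Prop :=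
  forall i j, gr (x - ν i + ν j) (X i j).

Section HGL.
Variables (n : nat) (ν : 'I_n -> Γ).

Definition hGL : {pred units 'M[A]_n} :=
  [pred X | `[< exists x, homogeneous_mx ν x (val X) >]].

Fact hGL_mulg_closed : mulg_closed hGL.
Proof.
move=> X Y /asboolP [x Xx] /asboolP [y Yy]; apply/asboolP; exists (x + y) => i k.
rewrite /= mxE; apply: piece_bigsum => j.
have -> : x + y - ν i + ν k = (x - ν i + ν j) + (y - ν j + ν k).
  by rewrite [y - _ + _]addrAC addrACA subrr addr0 addrA; congr (_ + _); rewrite addrAC.
exact: pieceM.
Qed.
Fact hGL1 : 1%g \in hGL.
Proof.
apply/asboolP; exists 0 => i j; rewrite /= mxE sub0r.
by case: eqP => [->|_]; rewrite ?addNr; [exact: piece1 | exact: piece0].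
Qed.
Fact hGL_invg_closed : invg_closed hGL.
Proof.
move=> X /asboolP [x Xx]; apply/asboolP; exists (- x).
have [] := units_inv_valP X; set Y := units_inv_val X => XY YX.
pose Y' : 'M[A]_n := \matrix_(i, j) component (Y i j) (- x - ν i + ν j).
have XY' : val X *m Y' = 1%:M.
  apply/matrixP => i k; rewrite !mxE.
  have -> : \sum_j val X i j * Y' j k = component ((val X *m Y) i k) (ν k - ν i).
    rewrite mxE component_sum; apply: eq_bigr => j _; rewrite mxE.
    rewrite -(component_mull _ _ (Xx i j)); congr (component _ _).
    by rewrite [- x - _ + _]addrAC addrACA subrr addr0 addrACA subrr add0r addrC.
  rewrite [val X *m Y]XY mxE.
  case: eqP => [->|_]; last by rewrite component0.
  by rewrite subrr (component_homog (piece1 gr)) eqxx.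
suff -> : val (X^-1)%g = Y'.
  by move=> i j; rewrite mxE; exact: component_piece.
by move: XY' => /(congr1 (fun Z => Y *m Z)); rewrite mulmxA [Y *m _]YX mul1mx mulmx1.
Qed.
HB.instance Definition _ := isMulClosed.Build (units 'M[A]_n) hGL hGL_mulg_closed.
HB.instance Definition _ := isMul1Closed.Build (units 'M[A]_n) hGL hGL1.
HB.instance Definition _ := isInvClosed.Build (units 'M[A]_n) hGL hGL_invg_closed.

End HGL.
End Grading.

Section Twist.
Variables (Γ : zmodType) (K : fieldType) (lam : Γ -> Γ -> units K).
Variables (A : algType K) (gr : comm_grading lam A) (ς : multiplier lam).

(* The bilinear extension of (a, b) |-> ς(x, y) a b on homogeneous a, b of degrees
   x, y: see star_homogeneous. *)
Definition star (a b : A) : A :=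
  \sum_(x <- finsupp (component gr a)) \sum_(y <- finsupp (component gr b))
    val (ς x y) *: (component gr a x * component gr b y).

Lemma star_sub (S T : {fset Γ}) a b :
  (finsupp (component gr a) `<=` S)%fset ->
  (finsupp (component gr b) `<=` T)%fset ->
  star a b = \sum_(x <- S) \sum_(y <- T)
    val (ς x y) *: (component gr a x * component gr b y).
Proof.
move=> aS bT; rewrite /star; transitivity (\sum_(x <- finsupp (component gr a))
    \sum_(y <- T) val (ς x y) *: (component gr a x * component gr b y)).
  apply: eq_bigr => x _; apply: big_fset_incl => // y _ yb.
  by rewrite (component_notin yb) mulr0 scaler0.
apply: big_fset_incl => // x _ xa; rewrite big1 // => y _.
by rewrite (component_notin xa) mul0r scaler0.
Qed.

Lemma star_homogeneous x y a b :
  gr x a -> gr y b -> star a b = val (ς x y) *: (a * b).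
Proof.
move=> ga gb.
have sub z c : gr z c -> (finsupp (component gr c) `<=` [fset z])%fset.
  move=> gc; apply/fsubsetP => t; rewrite mem_finsupp inE (component_homog gc).
  by case: ifP => // _; rewrite eqxx.
rewrite (star_sub (sub _ _ ga) (sub _ _ gb)) !big_seq_fset1.
by rewrite (component_homog ga) (component_homog gb) !eqxx.
Qed.

Fact star_linl c a a' b : star (c *: a + a') b = c *: star a b + star a' b.
Proof.
pose S := (finsupp (component gr (c *: a + a')) `|`
  (finsupp (component gr a) `|` finsupp (component gr a')))%fset.
have bT := fsubset_refl (finsupp (component gr b)).
have S1 : (finsupp (component gr (c *: a + a')) `<=` S)%fset by exact: fsubsetUl.
have S2 : (finsupp (component gr a) `<=` S)%fset.
  by apply: fsubset_trans (fsubsetUr _ _); exact: fsubsetUl.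
have S3 : (finsupp (component gr a') `<=` S)%fset.
  by apply: fsubset_trans (fsubsetUr _ _); exact: fsubsetUr.
rewrite (star_sub S1 bT) (star_sub S2 bT) (star_sub S3 bT).
rewrite scaler_sumr -big_split; apply: eq_bigr => x _ /=.
rewrite scaler_sumr -big_split; apply: eq_bigr => y _ /=.
rewrite component_lin mulrDl scalerDr -scalerAl !scalerA.
by rewrite [val _ * c]mulrC.
Qed.

Fact starC : commutative star.
Proof.
move=> a b; rewrite /star exchange_big; apply: eq_bigr => y _ /=.
apply: eq_bigr => x _; rewrite (piece_comm (component_piece gr a x) (component_piece gr b y)).
rewrite scalerA; congr (_ *: _); have /(congr1 val) := mult_twist ς x y.
have := congr1 val (mulVg (ς y x)); rewrite /= => vV.
move=> /(congr1 (fun k => k * val (ς y x))) /=.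
by rewrite mul1r -mulrA vV mulr1 mulrC.
Qed.

Fact star_linr c a b b' : star a (c *: b + b') = c *: star a b + star a b'.
Proof. by rewrite !(starC a) star_linl. Qed.

Fact starDl : left_distributive star +%R.
Proof. by move=> a b c; rewrite -[a in LHS]scale1r star_linl scale1r. Qed.
Fact starDr : right_distributive star +%R.
Proof. by move=> a b c; rewrite !(starC a) starDl. Qed.
Fact star0l b : star 0 b = 0.
Proof. by have := starDl 0 0 b; rewrite addr0 -[LHS]addr0 => /addrI. Qed.
Fact star0r a : star a 0 = 0. Proof. by rewrite starC star0l. Qed.

Fact star_suml (I : Type) (r : seq I) (F : I -> A) b :
  star (\sum_(i <- r) F i) b = \sum_(i <- r) star (F i) b.
Proof. by apply: (big_morph (star^~ b)) => [a c|]; rewrite ?starDl ?star0l. Qed.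
Fact star_sumr (I : Type) (r : seq I) (F : I -> A) a :
  star a (\sum_(i <- r) F i) = \sum_(i <- r) star a (F i).
Proof. by apply: (big_morph (star a)) => [b c|]; rewrite ?starDr ?star0r. Qed.

Fact starA : associative star.
Proof.
move=> a b c; rewrite -(sum_component gr a) -(sum_component gr b).
rewrite !star_suml; apply: eq_bigr => x _.
rewrite !star_sumr star_suml; apply: eq_bigr => y _.
rewrite -(sum_component gr c) !star_sumr.
apply: eq_bigr => z _.
have ga := component_piece gr a x; have gb := component_piece gr b y.
have gc := component_piece gr c z.
rewrite (star_homogeneous gb gc) (star_homogeneous ga gb).
rewrite (star_homogeneous ga (pieceZ _ (pieceM gb gc))).
rewrite (star_homogeneous (pieceZ _ (pieceM ga gb)) gc).
rewrite -scalerAl -scalerAr !scalerA mulrA; congr (_ *: _).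
have [ςl ςr] := mult_biadditive ς.
by rewrite ςl ςr /=; ring.
Qed.

Fact star1 : left_id 1 star.
Proof.
move=> a; rewrite -[in LHS](sum_component gr a) star_sumr -[RHS](sum_component gr a).
apply: eq_bigr => x _; rewrite (star_homogeneous (piece1 gr) (component_piece gr a x)).
have [ςl _] := mult_biadditive ς.
have -> : ς 0 x = 1%g.
  by apply: (@mulgI _ (ς 0 x)); rewrite -ςl addr0 mulg1.
by rewrite scale1r mul1r.
Qed.

(* The vector space A with the commutative product star; the grading and the
   multiplier only index the ring structure. *)
Definition twisted (_ : comm_grading lam A) (_ : multiplier lam) : Type := A.
HB.instance Definition _ := GRing.Lmodule.on (twisted gr ς).
HB.instance Definition _ := GRing.Zmodule_isComNzRing.Build (twisted gr ς)
  starA starC star1 starDl (oner_neq0 A).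
End Twist.

Section GradedDeterminant.
Variables (Γ : zmodType) (K : fieldType) (lam : Γ -> Γ -> units K).
Variables (A : algType K) (gr : comm_grading lam A) (ς : multiplier lam).

(* \det below is the determinant over the commutative ring twisted gr ς. *)
Definition Jmx n (ν : 'I_n -> Γ) (x : Γ) (X : 'M[A]_n) : 'M[twisted gr ς]_n :=
  \matrix_(i, j) (val (ς x (ν j) * (ς (ν i) (x - ν i + ν j))^-1)%g *: X i j).

Definition gdet n (ν : 'I_n -> Γ) (x : Γ) (X : 'M[A]_n) : A := \det (Jmx ν x X).

End GradedDeterminant.

Section ScalarQuotient.
Variables (Γ : zmodType) (K : fieldType) (lam : Γ -> Γ -> units K).
Variables (A : algType K) (gr : comm_grading lam A) (U : groupClosed (units K)).

Definition hunits := group_of (homogeneous_units gr).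

(* The subgroup U.1 of the group of homogeneous invertible elements. *)
Definition scalar_units : {pred hunits} :=
  [pred a | `[< exists2 c, c \in U & val (val a) = (val c)%:A >]].

Fact scalar_units_mulg_closed : mulg_closed scalar_units.
Proof.
move=> a b /asboolP [c Uc ac] /asboolP [d Ud bd]; apply/asboolP.
exists (c * d)%g; first exact: gpredM.
by rewrite /= ac bd -scalerAl mul1r scalerA.
Qed.
Fact scalar_units1 : 1%g \in scalar_units.
Proof. by apply/asboolP; exists 1%g; [exact: gpred1 | rewrite /= scale1r]. Qed.
Fact scalar_units_invg_closed : invg_closed scalar_units.
Proof.
move=> a /asboolP [c Uc ac]; apply/asboolP; exists (c^-1)%g; first by rewrite gpredV.
have cV : val c * val (c^-1)%g = 1 by have := congr1 val (mulgV c).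
have aV : val (val (a^-1)%g) * val (val a) = 1.
  by have := congr1 (fun u => val (val u)) (mulVg a).
move: aV; set w := val (val (a^-1)%g); rewrite ac -scalerAr mulr1 => cw.
by rewrite -[LHS]scale1r -cV mulrC -scalerA cw.
Qed.
HB.instance Definition _ :=
  isMulClosed.Build hunits scalar_units scalar_units_mulg_closed.
HB.instance Definition _ := isMul1Closed.Build hunits scalar_units scalar_units1.
HB.instance Definition _ :=
  isInvClosed.Build hunits scalar_units scalar_units_invg_closed.

Fact scalar_units_normal (a b : hunits) :
  a \in scalar_units -> (a ^ b)%g \in scalar_units.
Proof.
move=> aU; suff -> : (a ^ b)%g = a by [].
have /asboolP [c _ ac] := aU; rewrite conjgE -[RHS](mulKg b); congr (_ * _)%g.
by do 2 apply: val_inj; rewrite /= ac -scalerAl -scalerAr mul1r mulr1.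
Qed.

Definition hunits_mod := quotg scalar_units_normal.

(* f is the map sending X to the class of gdet X, with its values in the group of
   homogeneous invertible elements modulo U.1. The degree x is a parameter of
   gdet; an invertible X of positive size has only one degree. *)
Definition gdet_morphism (ς : multiplier lam) n (ν : 'I_n -> Γ) : Prop :=
  exists f : {multiplicative group_of (hGL gr ν) -> hunits_mod},
    forall (x : Γ) (X : group_of (hGL gr ν)),
      homogeneous_mx gr ν x (val (val X)) ->
      exists2 d : hunits,
        val (val d) = gdet gr ς ν x (val (val X)) & f X = \pi_hunits_mod d.

End ScalarQuotient.

(* Main.v *)
(** The twisted matrices satisfy J(X) ⋆ J(Y) = ς(x, y) J(XY) for X, Y homogeneous
    of degrees x, y.  Taking determinants gives det J(X) ⋆ det J(Y) =
    ς(x, y)^n gdet(XY).  Since det J(X) has degree n x, the product ⋆ on the left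
    is ς(n x, n y) = ς(x, y)^(n^2) times the product of the algebra.  Hence
    gdet(XY) = ς(x, y)^(n^2 - n) gdet(X) gdet(Y), and n^2 - n = 2 'C(n, 2) is
    even. *)
Require Import Defs.
From HB Require Import structures.
From mathcomp Require Import all_boot all_order all_algebra.
From mathcomp Require Import generic_quotient perm.
From mathcomp Require Import ring.
From mathcomp Require Import boolp classical_sets.

Set Implicit Arguments.
Unset Strict Implicit.
Unset Printing Implicit Defensive.

Import GRing.Theory.
Local Open Scope ring_scope.

(** * Generated subgroups and biadditive maps *)

Lemma generated_sub (G : groupType) (S : set G) (H : groupClosed G) :
  (forall x, S x -> x \in H) -> {subset generated S <= H}.
Proof. by move=> SH x /asboolP; apply. Qed.

Lemma mem_generated (G : groupType) (S : set G) x : S x -> x \in generated S.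
Proof. by move=> Sx; apply/asboolP => H; apply. Qed.

Section Biadditive.
Variables (Γ : zmodType) (G : groupType) (f : Γ -> Γ -> G).
Hypothesis fP : biadditive f.

Lemma biadditive0l y : f 0 y = 1%g.
Proof. by apply: (@mulgI _ (f 0 y)); rewrite -fP.1 addr0 mulg1. Qed.

Lemma biadditive0r x : f x 0 = 1%g.
Proof. by apply: (@mulgI _ (f x 0)); rewrite -fP.2 addr0 mulg1. Qed.

Lemma biadditiveNl x y : f (- x) y = ((f x y)^-1)%g.
Proof. by apply: (@mulgI _ (f x y)); rewrite -fP.1 subrr biadditive0l mulgV. Qed.

Lemma biadditiveNr x y : f x (- y) = ((f x y)^-1)%g.
Proof. by apply: (@mulgI _ (f x y)); rewrite -fP.2 subrr biadditive0r mulgV. Qed.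

Lemma biadditiveMnl x y n : f (x *+ n) y = (f x y ^+ n)%g.
Proof.
by elim: n => [|n IHn]; rewrite ?biadditive0l // mulrS fP.1 IHn expgS.
Qed.

Lemma biadditiveMnr x y n : f x (y *+ n) = (f x y ^+ n)%g.
Proof.
by elim: n => [|n IHn]; rewrite ?biadditive0r // mulrS fP.2 IHn expgS.
Qed.

End Biadditive.

(** Closure under subtraction together with [P 0] makes [P] a subgroup, which then contains every
    integer combination of the generators. *)
Lemma zmod_gen_ind (Γ : zmodType) (s : seq Γ) (P : Γ -> Prop) :
  (forall x, exists c : 'I_(size s) -> int, x = \sum_(i < size s) s`_i *~ c i) ->
  P 0 -> (forall x y, P x -> P y -> P (x - y)) ->
  (forall x, x \in s -> P x) -> forall x, P x.
Proof.
move=> sP P0 PB Ps x.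
have PN y : P y -> P (- y) by move=> Py; rewrite -sub0r; exact: PB.
have PD y z : P y -> P z -> P (y + z).
  by move=> Py Pz; rewrite -[z]opprK; apply: PB => //; apply: PN.
have PMn y n : P y -> P (y *+ n).
  by move=> Py; elim: n => [|n IHn] //; rewrite mulrS; exact: PD.
have [c ->] := sP x; elim/big_ind: _ => // i _.
have Pi : P s`_i by apply/Ps/mem_nth.
by case: (c i) => n; [exact: PMn | apply/PN/PMn].
Qed.

(** [c *: b] is a right inverse and [c' *: b] a left inverse of [a], so the two agree. The scalars
    may differ because [gdetM] attaches its own factor to each order of a product. *)
Lemma invertible_scale (K : fieldType) (A : algType K) (c c' : K) (a b : A) :
  c *: (a * b) = 1 -> c' *: (b * a) = 1 -> a \in @invertible A.
Proof.
rewrite scalerAr scalerAl => ab ba; apply/asboolP; exists (c *: b); split=> //.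
suff <- : c' *: b = c *: b by [].
by rewrite -[LHS]mulr1 -ab mulrA ba mul1r.
Qed.

(** * Units of a field and finite generation of the group of squares *)

Section UnitsField.
Variable K : fieldType.
Implicit Types u v : units K.

Lemma units_mulC u v : (u * v = v * u)%g.
Proof. by apply: val_inj; rewrite /= mulrC. Qed.

Lemma val_units_neq0 u : val u != 0.
Proof.
apply/eqP => u0; have /(congr1 val) := mulgV u.
by rewrite /= u0 mul0r => /esym/eqP; rewrite oner_eq0.
Qed.

Lemma val_unitsM u v : val (u * v)%g = val u * val v.
Proof. by []. Qed.

(** The inverse in [units K] is extracted from an existence statement; identifying it with the field
    inverse makes it accessible to [field]. *)
Lemma val_unitsV u : val (u^-1)%g = (val u)^-1.
Proof.
apply: (mulfI (val_units_neq0 u)); rewrite mulfV ?val_units_neq0 //.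
by have /(congr1 val) := mulgV u.
Qed.

Lemma val_unitsX u n : val (u ^+ n)%g = val u ^+ n.
Proof. by elim: n => // n IHn; rewrite expgS /= IHn exprS. Qed.

(** As [units K] is commutative, squaring preserves biadditivity. The squares at pairs of generators
    of [Γ] therefore generate all others, by induction on each argument in turn. *)
Lemma finitely_generated_squares (Γ : zmodType) (f : Γ -> Γ -> units K) :
  finitely_generated_zmod Γ -> biadditive f ->
  finitely_generated (generated (fun u => exists x y, u = (f x y ^+ 2)%g)).
Proof.
move=> [s sP] fP; pose t := [seq (f x y ^+ 2)%g | x <- s, y <- s].
exists t => u; apply/idP/idP; apply: generated_sub => {}u; last first.
  case/allpairsP => -[x y] /= [_ _ ->]; apply: mem_generated; by exists x, y.
case=> x [y ->].
have sqB v w : ((v / w) ^+ 2 = v ^+ 2 / w ^+ 2)%g.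
  by apply: expgnFl; exact: units_mulC.
apply: (zmod_gen_ind (P := fun x => f x y ^+ 2 \in generated _)%g sP) => [||{x}x xs].
- by rewrite biadditive0l // expg1n gpred1.
- by move=> x1 x2 P1 P2; rewrite fP.1 biadditiveNl // sqB gpredF.
apply: (zmod_gen_ind (P := fun y => f x y ^+ 2 \in generated _)%g sP) => [||{y}y ys].
- by rewrite biadditive0r // expg1n gpred1.
- by move=> y1 y2 P1 P2; rewrite fP.2 biadditiveNr // sqB gpredF.
by apply: mem_generated; exact: allpairs_f.
Qed.

End UnitsField.

(** * Degree and multiplicativity of the graded determinant *)

Section GradedDeterminantTheory.
Variables (Γ : zmodType) (K : fieldType) (lam : Γ -> Γ -> units K).
Variables (A : algType K) (gr : comm_grading lam A) (ς : multiplier lam).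
Local Notation T := (twisted gr ς).

Lemma piece_uniq x y a : gr x a -> gr y a -> a != 0 -> x = y.
Proof.
move=> xa ya /eqP a0; apply/eqP/negP => /negP /negPf xy; apply: a0.
by have := component_homog xa x; rewrite (component_homog ya) xy eqxx.
Qed.

(** Scalars enter the ring [T] as multiples of its unit; this turns a factor extracted by [detZ]
    back into an action of [K]. *)
Lemma star_algr (c : K) (a : T) : (c%:A : T) * a = c *: a.
Proof.
by have := star_linl gr ς c 1 0 a; rewrite star0l star1 !addr0.
Qed.

Lemma star_algX (c : K) n : (c%:A : T) ^+ n = (c ^+ n)%:A.
Proof.
elim: n => [|n IHn]; first by rewrite !expr0 scale1r.
by rewrite exprS IHn star_algr scalerA -exprS.
Qed.

Lemma twisted_mulE (x y : Γ) (a b : A) :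
  gr x a -> gr y b -> (a : T) * (b : T) = val (ς x y) *: (a * b) :> A.
Proof. exact: star_homogeneous. Qed.

Lemma piece_star x y (a b : T) : gr x a -> gr y b -> gr (x + y) (a * b).
Proof.
by move=> xa yb; rewrite (twisted_mulE xa yb); apply/pieceZ/pieceM.
Qed.

(** Each Leibniz term is a ⋆-product of entries of degrees [x - ν i + ν (s i)]. Summed over [i], the
    [ν] terms cancel because [s] permutes the indices. *)
Lemma piece_gdet n (ν : 'I_n -> Γ) x X :
  homogeneous_mx gr ν x X -> gr (x *+ n) (gdet gr ς ν x X).
Proof.
move=> Xx; rewrite /gdet /determinant; apply: piece_bigsum => s.
have gs : gr (x *+ n) (\prod_i Jmx gr ς ν x X i (s i)).
  have -> : x *+ n = \sum_(i < n) (x - ν i + ν (s i)).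
    rewrite !big_split /= sumr_const card_ord sumrN.
    by rewrite [\sum_(i < n) ν i](reindex_inj (@perm_inj _ s)) /= addrNK.
  elim/big_rec2: _ => [|i y a _ ya]; first exact: piece1.
  by apply: piece_star => //; rewrite mxE; apply: pieceZ.
rewrite mulr_sign; case: ifP => // _.
rewrite -[X in gr _ X]scaleN1r; exact: pieceZ gs.
Qed.

Lemma Jmx1 n (ν : 'I_n -> Γ) : Jmx gr ς ν 0 1%:M = 1%:M.
Proof.
have ςP := mult_biadditive ς.
apply/matrixP => i j; rewrite !mxE; case: eqP => [<-|_]; last exact: scaler0.
rewrite sub0r addNr (biadditive0l ςP) (biadditive0r ςP) mulgV.
exact: scale1r.
Qed.

Lemma gdet1 n (ν : 'I_n -> Γ) : gdet gr ς ν 0 1%:M = 1.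
Proof. by rewrite /gdet Jmx1 det1. Qed.

(* In additive notation for ς, both sides multiply every X_ij Y_jk by
   ς(x, y) + ς(x + y, ν_k) - ς(ν_i, x + y - ν_i + ν_k), which does not
   depend on j. *)
Lemma JmxM n (ν : 'I_n -> Γ) x y X Y :
  homogeneous_mx gr ν x X -> homogeneous_mx gr ν y Y ->
  Jmx gr ς ν x X *m Jmx gr ς ν y Y =
  ((val (ς x y))%:A : T) *: Jmx gr ς ν (x + y) (X *m Y).
Proof.
move=> Xx Yy; have ςP := mult_biadditive ς.
apply/matrixP => i k; rewrite !mxE star_algr scalerA scaler_sumr.
apply: eq_bigr => j _; rewrite !mxE.
rewrite (twisted_mulE (pieceZ _ (Xx i j)) (pieceZ _ (Yy j k))).
rewrite -scalerAl -scalerAr !scalerA; congr (_ *: _).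
rewrite !(ςP.1, ςP.2, biadditiveNl ςP, biadditiveNr ςP).
rewrite !(val_unitsM, val_unitsV).
by field; rewrite ?val_units_neq0 ?oner_neq0.
Qed.

Lemma gdetM n (ν : 'I_n -> Γ) x y X Y :
  homogeneous_mx gr ν x X -> homogeneous_mx gr ν y Y ->
  gdet gr ς ν (x + y) (X *m Y) =
  val ((ς x y ^+ 2) ^+ 'C(n, 2))%g *: (gdet gr ς ν x X * gdet gr ς ν y Y).
Proof.
move=> Xx Yy; have ςP := mult_biadditive ς.
have := congr1 determinant (JmxM Xx Yy).
rewrite det_mulmx detZ star_algX star_algr.
rewrite (twisted_mulE (piece_gdet Xx) (piece_gdet Yy)).
rewrite (biadditiveMnl ςP) (biadditiveMnr ςP) -expgnA -val_unitsX => E.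
(* The inverse undoes the scalar in front of det J(XY); the power [n * n] comes from ⋆ in degrees
   [x *+ n] and [y *+ n]. *)
have -> : ((ς x y ^+ 2) ^+ 'C(n, 2) = (ς x y ^+ n)^-1 * ς x y ^+ (n * n))%g.
  have -> : (n * n = n + 2 * 'C(n, 2))%N.
    (* Twice the binomial is the falling factorial n (n - 1); [n = 0] is split off because the
       subtraction is truncated. *)
    rewrite mulnC -[(2 : nat) in RHS]/(2`!) bin_ffact ffactnSr ffactn1.
    by case: (n) => // m; rewrite subn1 -mulnS.
  by rewrite expgnDr mulKg expgnA.
by rewrite val_unitsM -scalerA [X in _ *: X]E scalerA -val_unitsM mulVg scale1r.
Qed.

(** * Uniqueness of the degree and invertibility of the determinant *)

Lemma homogeneous_mx1 n (ν : 'I_n -> Γ) : homogeneous_mx gr ν 0 1%:M.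
Proof.
move=> i j; rewrite mxE sub0r.
by case: eqP => [->|_]; rewrite ?addNr; [exact: piece1 | exact: piece0].
Qed.

Lemma homogeneous_mxM n (ν : 'I_n -> Γ) x y X Y :
  homogeneous_mx gr ν x X -> homogeneous_mx gr ν y Y ->
  homogeneous_mx gr ν (x + y) (X *m Y).
Proof.
move=> Xx Yy i k; rewrite mxE; apply: piece_bigsum => j.
have -> : x + y - ν i + ν k = (x - ν i + ν j) + (y - ν j + ν k).
  rewrite [y - _ + _]addrAC addrACA subrr addr0 addrA; congr (_ + _).
  exact: addrAC.
exact: pieceM.
Qed.

(** The first row of an invertible matrix has a nonzero entry, whose degree fixes that of the
    matrix. An empty matrix has every degree, hence [0 < n]. *)
Lemma homogeneous_mx_degree n (ν : 'I_n -> Γ) x y (X : units 'M[A]_n) :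
  (0 < n)%N -> homogeneous_mx gr ν x (val X) -> homogeneous_mx gr ν y (val X) ->
  x = y.
Proof.
move=> n_gt0 Xx Xy; pose i := Ordinal n_gt0.
have [j Xij] : exists j, val X i j != 0.
  apply/existsP; apply: contraT; rewrite negb_exists => /forallP Xi0.
  (* With a zero row, the diagonal entry at [i] of the product with the inverse would be 0 instead
     of 1. *)
  have [/matrixP /(_ i i)] := units_inv_valP X.
  rewrite !mxE eqxx big1 => [/esym/eqP|j _]; first by rewrite oner_eq0.
  by have /eqP -> := negbNE (Xi0 j); rewrite mul0r.
by have /addIr/addIr := piece_uniq (Xx i j) (Xy i j) Xij.
Qed.

(** The inverse matrix has some degree [y], and [x + y = 0] since the identity has degree 0 only.
    Then [gdetM], applied to both products, inverts the determinant on either side up to scalars. *)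
Lemma gdet_unit n (ν : 'I_n -> Γ) x (X : group_of (hGL gr ν)) :
  (0 < n)%N -> homogeneous_mx gr ν x (val (val X)) ->
  exists d : hunits gr, val (val d) = gdet gr ς ν x (val (val X)).
Proof.
move=> n_gt0 Xx; have /asboolP [y Yy] := valP (X^-1)%g.
pose Y := val (val (X^-1)%g); have XY : val (val X) *m Y = 1%:M.
  by have := congr1 (fun Z => val (val Z)) (mulgV X).
have YX : Y *m val (val X) = 1%:M.
  by have := congr1 (fun Z => val (val Z)) (mulVg X).
have xy0 : x + y = 0.
  apply: (@homogeneous_mx_degree n ν _ _ 1%g n_gt0); last exact: homogeneous_mx1.
  by have := homogeneous_mxM Xx Yy; rewrite XY.
have := gdetM Yy Xx; have := gdetM Xx Yy.
rewrite XY YX [y + x]addrC xy0 gdet1.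
move=> /esym ab /esym ba; have a_unit := invertible_scale ab ba.
pose u : units A := exist (fun a => a \in @invertible A) _ a_unit.
have u_homog : u \in homogeneous_units gr.
  by apply/asboolP; exists (x *+ n); exact: piece_gdet.
by exists (exist (fun u => u \in homogeneous_units gr) u u_homog).
Qed.

(** * The morphism to the quotient by scalars *)

Lemma gdet_morphism_squares (U : groupClosed (units K)) n (ν : 'I_n -> Γ) :
  (forall x y, (ς x y ^+ 2)%g \in U) -> (0 < n)%N -> gdet_morphism gr U ς ν.
Proof.
move=> Usq n_gt0; pose H := group_of (hGL gr ν); pose Q := hunits_mod gr U.
(* A degree and a determinant are chosen for each matrix; [degE] shows that the degree is forced. *)
have /choice [deg degP] : forall X : H, exists x, homogeneous_mx gr ν x (val (val X)).
  by move=> X; exact: asboolW (valP X).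
have /choice [d dP] : forall X : H, exists d : hunits gr,
    val (val d) = gdet gr ς ν (deg X) (val (val X)).
  by move=> X; exact: gdet_unit.
have degE x (X : H) : homogeneous_mx gr ν x (val (val X)) -> x = deg X.
  by move=> Xx; exact: homogeneous_mx_degree Xx (degP X).
pose f (X : H) : Q := \pi_Q%qT (d X).
have fM : {morph f : X Y / (X * Y)%g}.
  move=> X Y; have XYh := homogeneous_mxM (degP X) (degP Y).
  rewrite /f; transitivity (\pi_Q%qT (d X * d Y)%g); last first.
    exact: pi_quotg_mul.
  apply/eqmodP; rewrite /= /coset_rel; apply/asboolP.
  (* The factor from [gdetM], which lies in [U] as a power of a square. *)
  exists ((ς (deg X) (deg Y) ^+ 2) ^+ 'C(n, 2))%g; first exact: gpredXn.
  have dM : val (val (d (X * Y)%g)) =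
      val ((ς (deg X) (deg Y) ^+ 2) ^+ 'C(n, 2))%g *: val (val (d X * d Y)%g).
    have vM : val (val (X * Y)%g) = val (val X) *m val (val Y) by [].
    have -> : val (val (d X * d Y)%g) = val (val (d X)) * val (val (d Y)) by [].
    have degM : deg (X * Y)%g = deg X + deg Y by apply/esym/degE; rewrite vM.
    by rewrite !dP degM vM; exact: gdetM.
  have := congr1 (fun u => val (val u)) (mulgV (d X * d Y)%g) => /= dV.
  by rewrite /= dM /= -scalerAl dV.
pose F := HB.pack_for {multiplicative H -> Q} f (isMultiplicative.Build H Q f fM).
exists F => x X Xx; exists (d X); last exact: erefl.
by rewrite dP (degE _ _ Xx).
Qed.

End GradedDeterminantTheory.

Theorem proposition6p3
    (K : fieldType) (charK : [pchar K] =i pred0)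
    (Γ : zmodType) (fgΓ : finitely_generated_zmod Γ)
    (lam : Γ -> Γ -> units K) (lamP : commutation_factor lam)
    (lam_even : forall x : Γ, lam x x = 1%g)
    (A : algType K) (gr : comm_grading lam A)
    (ς : multiplier lam) :
  let good (U : groupClosed (units K)) : Prop :=
    finitely_generated U /\
    forall (n : nat) (ν : 'I_n -> Γ), (0 < n)%N -> gdet_morphism gr U ς ν in
  (exists U : groupClosed (units K), good U) /\
  good (generated (fun u : units K => exists x y : Γ, u = (ς x y ^+ 2)%g)).
Proof.
(* The group generated by the squares also witnesses the existence claim. *)
move=> good; suff goodU : good (generated
    (fun u : units K => exists x y : Γ, u = (ς x y ^+ 2)%g)).
  by split; [eexists; exact: goodU | exact: goodU].
split; first exact: finitely_generated_squares fgΓ (mult_biadditive ς).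
move=> n ν; apply: gdet_morphism_squares => x y.
by apply: mem_generated; exists x, y.
Qed.
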